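(* Let $E$ be a row-finite directed graph with no sources and let $R$ be an integral domain with identity. Let $m,n\in N(E)$ and $d\in D(E)$. (1) We have $x\in \operatorname{Dom}(mn)$ if and only if $x\in \operatorname{Dom}(n)$ and $\alpha_n(x)\in \operatorname{Dom}(m)$, and then $\alpha_{m}\circ\alpha_n=\alpha_{mn}$ (that is, $\alpha_m(\alpha_n(x))=\alpha_{mn}(x)$ for $x\in\operatorname{Dom}(mn)$). (2) If $x\in\operatorname{supp}(d)=\operatorname{Dom}(d)$, then $\alpha_d(x)=x$. (3) The map $\alpha_n$ is a homeomorphism of $\operatorname{Dom}(n)$ onto $\operatorname{Ran}(n)=\operatorname{Dom}(n^* )$ with $\alpha_n^{-1}=\alpha_{n^*}$.
   Context: A directed graph $E=(E^0,E^1,r,s)$ consists of countable sets $E^0$ (vertices), $E^1$ (edges) and maps $r,s:E^1\to E^0$. It is row-finite if $r^{-1}(v)$ is finite for every $v\in E^0$, and has no sources if $r^{-1}(v)\neq\emptyset$ for every $v$. Paths are sequences of edges $\mu=\mu_1\mu_2\cdots$ with $s(\mu_i)=r(\mu_{i+1})$; $P(E)$ is the set of finite paths (vertices are paths of length $0$, with $r(v)=s(v)=v$), $|\mu|$ is the length of $\mu\in P(E)$, $r(\mu)=r(\mu_1)$, $s(\mu)=s(\mu_{|\mu|})$, and $E^\infty$ is the set of infinite paths. Graph groupoid: $G_E$ is the set of triples $(x,k,y)\in E^\infty\times\mathbb{Z}\times E^\infty$ such that there are $\mu,\nu\in P(E)$ and $z\in E^\infty$ with $x=\mu z$, $y=\nu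 z$, $k=|\mu|-|\nu|$; $r(x,k,y)=x$, $s(x,k,y)=y$, $(x,k,y)(y,l,z)=(x,k+l,z)$, $(x,k,y)^{-1}=(y,-k,x)$, and $x\in E^\infty$ is identified with the unit $(x,0,x)$. For $\mu,\nu\in P(E)$ with $s(\mu)=s(\nu)$ put $Z(\mu,\nu)=\{(\mu z,|\mu|-|\nu|,\nu z): z\in E^\infty, r(z)=s(\mu)\}$; these sets form a basis for the (Hausdorff) topology of $G_E$, and are compact. $Z(\mu)=\{\mu z\}$ is identified with $Z(\mu,\mu)$, and $E^\infty$ has the topology with basis the $Z(\mu)$. For $B\subset G_E$ and $x\in E^\infty$, $Bx=\{\gamma\in B:s(\gamma)=x\}$. The integral domain $R$ has an involution $r\mapsto\overline r$ (a ring automorphism with $\overline{\overline r}=r$). The Leavitt path algebra $L_R(E)$ is viewed as the Steinberg algebra of $G_E$: the $R$-span of the characteristic functions $\mathbf 1_{Z(\mu,\nu)}:G_E\to R$, with convolution product $f*g(\gamma)=\sum_{r(\eta)=r(\gamma)}f(\eta)g(\eta^{-1}\gamma)$ (also written $fg$) and involution $f^*(\gamma)=\overline{f(\gamma^{-1})}$. $\operatorname{supp}(f)=\{\gamma:f(\gamma)\neq0\}$. The diagonal is $D(E)=\operatorname{span}_R\{\mathbf 1_{Z(\mu)}:\mu\in P(E)\}$. An element $n\in L_R(E)$ is a normalizer of $D(E)$ if $ndn^*,\,n^*dn\in D(E)$ for all $d\in D(E)$; $N(E)$ is the set of normalizers. It is closed under products and $*$, contains $D(E)$, and $nn^*,n^*n\in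 D(E)$ for $n\in N(E)$. For $n\in N(E)$: $\operatorname{Dom}(n)=\operatorname{supp}(n^*n)\subset E^\infty$ and $\operatorname{Ran}(n)=\operatorname{supp}(nn^* )\subset E^\infty$. For $x\in s(\operatorname{supp}(n))$ the set $r(\operatorname{supp}(n)x)$ is a singleton, and $\alpha_n(x)$ denotes its unique element. *)

(* Defs.v *)
From HB Require Import structures.
From mathcomp Require Import all_boot all_order all_algebra.
From mathcomp Require Import zify.
From mathcomp Require Import all_classical all_reals all_analysis.
Set Implicit Arguments.
Unset Strict Implicit.
Unset Printing Implicit Defensive.
Import Order.TTheory GRing.Theory Num.Theory.

Local Open Scope classical_set_scope.
Local Open Scope ring_scope.

Record graph := Graph {
  vertex : countType;
  edge : countType;
  er : edge -> vertex;
  es : edge -> vertex }.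

Definition row_finite (E : graph) :=
  forall v : vertex E, finite_set [set e : edge E | er e = v].

Definition no_sources (E : graph) :=
  forall v : vertex E, [set e : edge E | er e = v] !=set0.

(* Paths run from right to left: s(mu_i) = r(mu_(i+1)). *)
Fixpoint is_path (E : graph) (v : vertex E) (p : seq (edge E)) : bool :=
  if p is e :: p' then (er e == v) && is_path (es e) p' else true.

(* The range vertex is part of the data, so that the empty edge sequence at [v]
   is the path of length 0 given by the vertex [v]. *)
Record fpath (E : graph) := FPath {
  frange : vertex E;
  fedges :> seq (edge E);
  fpathP : is_path frange fedges }.

Definition fsource (E : graph) (mu : fpath E) : vertex E :=
  last (frange mu) (map (@es E) mu).

Record infpath (E : graph) := InfPath {
  iedge :> nat -> edge E;
  iedgeP : forall i, es (iedge i) = er (iedge i.+1) }.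

HB.instance Definition _ (E : graph) := gen_eqMixin (infpath E).
HB.instance Definition _ (E : graph) := gen_choiceMixin (infpath E).

Definition irange (E : graph) (x : infpath E) : vertex E := er (x 0%N).

Definition icat (E : graph) (mu : fpath E) (z : nat -> edge E) : nat -> edge E :=
  fun i => nth (z (i - size mu)%N) mu i.

(* x = mu z; composability of mu and z is part of the relation *)
Definition is_icat (E : graph) (mu : fpath E) (z x : infpath E) : Prop :=
  fsource mu = irange z /\ iedge x = icat mu z.

Definition cylinder (E : graph) (mu : fpath E) : set (infpath E) :=
  [set x | exists z, is_icat mu z x].

Lemma fpath_eq (E : graph) (mu nu : fpath E) :
  frange mu = frange nu -> fedges mu = fedges nu -> mu = nu.
Proof.
case: mu nu => [v p pP] [w q qP] /= vw pq; subst w q.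
congr FPath; exact: Prop_irrelevance.
Qed.

Lemma infpath_eq (E : graph) (x y : infpath E) : x =1 y -> x = y.
Proof.
case: x y => x xP [y yP] /= /funext xy; subst y.
congr InfPath; exact: Prop_irrelevance.
Qed.

Lemma is_path_mkseq (E : graph) n (x : nat -> edge E) :
  (forall i, es (x i) = er (x i.+1)) -> is_path (er (x 0%N)) (mkseq x n).
Proof.
elim: n x => // n IHn x xP; rewrite /mkseq /= eqxx /=.
rewrite xP -[1%N]addn0 iotaDl -map_comp.
by apply: (IHn (fun i => x i.+1)) => i; exact: xP.
Qed.

Definition iprefix (E : graph) (x : infpath E) (n : nat) : fpath E :=
  FPath (is_path_mkseq n (@iedgeP E x)).

Lemma ishift_subproof (E : graph) (x : infpath E) (n i : nat) :
  es (x (n + i)%N) = er (x (n + i.+1)%N).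
Proof. by rewrite iedgeP addnS. Qed.

Definition ishift (E : graph) (x : infpath E) (n : nat) : infpath E :=
  InfPath (ishift_subproof x n).

Lemma ishiftD (E : graph) (x : infpath E) a b :
  ishift (ishift x a) b = ishift x (a + b).
Proof. by apply: infpath_eq => i /=; rewrite addnA. Qed.

Lemma size_iprefix (E : graph) (x : infpath E) n : size (iprefix x n) = n.
Proof. by rewrite /= size_mkseq. Qed.

Lemma is_icat_prefix (E : graph) (x : infpath E) n :
  is_icat (iprefix x n) (ishift x n) x.
Proof.
split.
  rewrite /fsource /irange /= addn0; case: n => [//|n].
  by rewrite /mkseq -addn1 iotaD !map_cat last_cat /= addn1 iedgeP.
apply/funext => i; rewrite /icat /= size_mkseq.
have [lt_in|le_ni] := ltnP i n; first by rewrite nth_mkseq.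
by rewrite nth_default ?size_mkseq // subnKC.
Qed.

Lemma is_icatE (E : graph) (mu : fpath E) (z x : infpath E) :
  is_icat mu z x <-> mu = iprefix x (size mu) /\ z = ishift x (size mu).
Proof.
split=> [[sz xz]|[muE ->]]; last by rewrite {1}muE; exact: is_icat_prefix.
split; last first.
  apply: infpath_eq => i /=; rewrite xz /icat.
  by rewrite nth_default ?leq_addr // addKn.
apply: fpath_eq => /=.
  rewrite /irange xz /icat; have := fpathP mu.
  by move: sz {xz}; rewrite /fsource; case: (fedges mu) => [|e p] //= _ /andP[/eqP].
apply: (@eq_from_nth _ (z 0%N)) => [|i lti]; rewrite ?size_mkseq //.
rewrite nth_mkseq // xz /icat; exact: set_nth_default.
Qed.

Lemma cylinderE (E : graph) (mu : fpath E) (x : infpath E) :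
  cylinder mu x <-> mu = iprefix x (size mu).
Proof.
split=> [[z /is_icatE[]] //|muE].
by exists (ishift x (size mu)); apply/is_icatE.
Qed.

Lemma iprefix_le (E : graph) (x y : infpath E) m n : (m <= n)%N ->
  iprefix x n = iprefix y n -> iprefix x m = iprefix y m.
Proof.
move=> lemn xy; apply: fpath_eq; first exact: (congr1 (@frange E) xy).
have := congr1 (fun p : fpath E => take m p) xy.
by rewrite /= /mkseq -!map_take take_iota (minn_idPl lemn).
Qed.

Lemma cylinder_cover (E : graph) :
  \bigcup_(A in range (@cylinder E)) A = [set: infpath E].
Proof.
apply/seteqP; split=> // x _; exists (cylinder (iprefix x 0)); first by exists (iprefix x 0).
by apply/cylinderE; rewrite size_iprefix.
Qed.

Lemma cylinder_join (E : graph) (A B : set (infpath E)) (x : infpath E) :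
  range (@cylinder E) A -> range (@cylinder E) B -> A x -> B x ->
  exists C, [/\ range (@cylinder E) C, C x & C `<=` A `&` B].
Proof.
move=> [mu _ <-] [nu _ <-] /cylinderE mux /cylinderE nux.
pose n := maxn (size mu) (size nu).
exists (cylinder (iprefix x n)); split; first by exists (iprefix x n).
  by apply/cylinderE; rewrite size_iprefix.
move=> y /cylinderE; rewrite size_iprefix => xy.
split; apply/cylinderE.
  by rewrite {1}mux; apply: iprefix_le xy; rewrite leq_maxl.
by rewrite {1}nux; apply: iprefix_le xy; rewrite leq_maxr.
Qed.

HB.instance Definition _ (E : graph) := @isBaseTopological.Build (infpath E)
  (set (infpath E)) (range (@cylinder E)) id
  (@cylinder_cover E) (@cylinder_join E).

Definition in_groupoid (E : graph) (x : infpath E) (k : int) (y : infpath E) : Prop :=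
  exists (mu nu : fpath E) (z : infpath E),
    [/\ is_icat mu z x, is_icat nu z y & k = (size mu)%:Z - (size nu)%:Z].

Record groupoid (E : graph) := Groupoid {
  grange : infpath E;
  gdeg : int;
  gsource : infpath E;
  groupoidP : in_groupoid grange gdeg gsource }.

HB.instance Definition _ (E : graph) := gen_eqMixin (groupoid E).
HB.instance Definition _ (E : graph) := gen_choiceMixin (groupoid E).

Lemma in_groupoidE (E : graph) (x : infpath E) k (y : infpath E) :
  in_groupoid x k y <->
  exists a b : nat, k = a%:Z - b%:Z /\ ishift x a = ishift y b.
Proof.
split=> [[mu [nu [z [/is_icatE[_ zx] /is_icatE[_ zy] ->]]]]|[a [b [-> xy]]]].
  by exists (size mu), (size nu); rewrite -zx -zy.
exists (iprefix x a), (iprefix y b), (ishift x a); split.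
- exact: is_icat_prefix.
- by rewrite xy; exact: is_icat_prefix.
- by rewrite !size_iprefix.
Qed.

Lemma gunit_subproof (E : graph) (x : infpath E) : in_groupoid x 0 x.
Proof. by apply/in_groupoidE; exists 0%N, 0%N. Qed.

Definition gunit (E : graph) (x : infpath E) : groupoid E :=
  Groupoid (gunit_subproof x).

Lemma ginv_subproof (E : graph) (g : groupoid E) :
  in_groupoid (gsource g) (- gdeg g) (grange g).
Proof.
have [mu [nu [z [xz yz ->]]]] := groupoidP g.
by exists nu, mu, z; split=> //; rewrite opprB.
Qed.

Definition ginv (E : graph) (g : groupoid E) : groupoid E :=
  Groupoid (ginv_subproof g).

Lemma gcomp_subproof (E : graph) (g h : groupoid E) :
  gsource g = grange h ->
  in_groupoid (grange g) (gdeg g + gdeg h) (gsource h).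
Proof.
have /in_groupoidE[a [b [-> xy]]] := groupoidP g.
have /in_groupoidE[c [d [-> yz]]] := groupoidP h => gh.
apply/in_groupoidE; exists (a + c)%N, (d + b)%N; split; first by lia.
by rewrite -ishiftD xy gh ishiftD addnC -ishiftD yz ishiftD.
Qed.

Definition gcomp (E : graph) (g h : groupoid E) (gh : gsource g = grange h) :
  groupoid E := Groupoid (gcomp_subproof gh).

(* Total extension of [gcomp]; the value on non-composable pairs is never used. *)
Definition gmul (E : graph) (g h : groupoid E) : groupoid E :=
  if pselect (gsource g = grange h) is left gh then gcomp gh else g.

Definition Zset (E : graph) (mu nu : fpath E) : set (groupoid E) :=
  [set g | exists z, [/\ is_icat mu z (grange g), is_icat nu z (gsource g)
                       & gdeg g = (size mu)%:Z - (size nu)%:Z]].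

Section Steinberg.
Variables (E : graph) (R : idomainType).
Implicit Types f g n : groupoid E -> R.

Definition fspan (S : set (groupoid E -> R)) : set (groupoid E -> R) :=
  [set f | exists (k : nat) (c : 'I_k -> R) (b : 'I_k -> groupoid E -> R),
     (forall i, S (b i)) /\ f = fun gam => \sum_(i < k) c i * b i gam].

Definition leavitt : set (groupoid E -> R) :=
  fspan [set f | exists mu nu : fpath E,
    fsource mu = fsource nu /\ f = \1_(Zset mu nu)].

(* Z(mu) is identified with Z(mu, mu). *)
Definition leavitt_diagonal : set (groupoid E -> R) :=
  fspan [set f | exists mu : fpath E, f = \1_(Zset mu mu)].

(* A sum with finitely many nonzero terms, for f and g in [leavitt]. *)
Definition convol f g : groupoid E -> R := fun gam =>
  \sum_(eta \in [set eta | grange eta = grange gam])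
    (f eta * g (gmul (ginv eta) gam)).

Definition fstar (bar : R -> R) f : groupoid E -> R :=
  fun gam => bar (f (ginv gam)).

Definition supp f : set (groupoid E) := [set gam | f gam != 0].

Definition leavitt_normalizer (bar : R -> R) : set (groupoid E -> R) :=
  [set n | leavitt n /\ forall d, leavitt_diagonal d ->
    leavitt_diagonal (convol (convol n d) (fstar bar n)) /\
    leavitt_diagonal (convol (convol (fstar bar n) d) n)].

(* Subsets of the unit space are identified with sets of infinite paths. *)
Definition Dom (bar : R -> R) n : set (infpath E) :=
  @gunit E @^-1` supp (convol (fstar bar n) n).

Definition Ran (bar : R -> R) n : set (infpath E) :=
  @gunit E @^-1` supp (convol n (fstar bar n)).

(* For a normalizer n and x in s(supp n), the set r(supp(n) x) is a singleton
   and [alpha n x] is its element; the default value x is only used outside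
   s(supp n). *)
Definition alpha n (x : infpath E) : infpath E :=
  xget x (@grange E @` (supp n `&` [set gam | gsource gam = x])).

End Steinberg.

(* Main.v *)
From mathcomp Require Import all_boot all_order all_algebra.
From mathcomp Require Import zify.
From mathcomp Require Import all_classical all_reals all_analysis.
Require Import Defs.
Import Order.TTheory GRing.Theory Num.Theory.
Local Open Scope classical_set_scope.
Local Open Scope ring_scope.

(** Everything follows from one fact: the support of a normalizer n is a
    bisection, that is, both r and s are injective on supp n
    ([normalizer_inj_source], [normalizer_inj_range]).

    To see that s is injective, let g and h in supp n have the same source x.
    If d in D(E) is the indicator of a small cylinder around x, then the
    coefficient of n d n^* at g h^-1 is the sum of n(e) bar(n(h g^-1 e)) over
    the elements e : x -> r(g) of supp n. This is like a coefficient of a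
    product of Laurent polynomials in the degree: when g has the largest degree
    among the elements x -> r(g) of supp n and h the smallest among the elements
    x -> r(h), only the term e = g survives, and n(g) bar(n(h)) is nonzero
    because R is a domain and bar is injective. Since n d n^* is in D(E), it is
    supported on units, so g h^-1 is a unit ([normalizer_extremal]). Hence all
    ranges and all extremal degrees coincide, and supp n has at most one element
    with source x. Injectivity of r is the same fact for n^*.

    When supports are bisections, each convolution has at most one nonzero
    term. So Dom(n) = s(supp n), alpha_n maps s(g) to r(g) for g in supp n, and
    supp(mn) is the set of products of composable elements of supp m and supp n.
    Parts (1) and (2) and the bijectivity in (3) are read off from this, as
    supp(n^* ) is the inverse of supp n. For continuity, n is locally constant,
    so supp n contains a bisection Z(mu, nu) around each of its elements, with
    mu and nu as long as one likes; on Z(nu) the map alpha_n replaces the prefix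
    nu by mu ([alpha_continuous]). *)

(** * Cylinders in the path space *)

Section PathSpace.
Set Implicit Arguments.
Unset Strict Implicit.
Variable E : graph.
Implicit Types (mu nu : fpath E) (x y z : infpath E).

Lemma cylinder_iprefix x y N :
  cylinder (iprefix x N) y <-> iprefix x N = iprefix y N.
Proof. by rewrite cylinderE size_iprefix. Qed.

Lemma iprefix_nth x y N i :
  iprefix x N = iprefix y N -> (i < N)%N -> x i = y i.
Proof.
move=> /(congr1 (fun p : fpath E => nth (x 0%N) p i)) /= xy ltiN.
by rewrite !nth_mkseq in xy.
Qed.

Lemma iprefix_inj x y : (forall N, iprefix x N = iprefix y N) -> x = y.
Proof. by move=> xy; apply: infpath_eq => i; exact: iprefix_nth (xy i.+1) _. Qed.

Lemma is_icat_inj mu z x y : is_icat mu z x -> is_icat mu z y -> x = y.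
Proof. by move=> [_ xE] [_ yE]; apply: infpath_eq => i; rewrite xE yE. Qed.

(** The relation [is_icat mu z x] is realised by an actual infinite path as
    soon as mu and z are composable. *)
Lemma icat_exists mu z : fsource mu = irange z -> exists x, is_icat mu z x.
Proof.
move=> muz; suff xP i : es (icat mu z i) = er (icat mu z i.+1).
  by exists (InfPath xP).
case: mu muz => v p; rewrite /fsource /icat /=.
elim: p v i => [|e p IHp] v i /=; first by rewrite !nth_nil !subn0 iedgeP.
move=> /andP[_ pP] lz; case: i => [|i]; last by rewrite !subSS; exact: IHp pP lz.
rewrite subSS sub0n /=; case: p pP lz {IHp} => [//|e' p /=].
by move=> /andP[/eqP ->].
Qed.

Lemma nbhs_cylinderP x (A : set (infpath E)) :
  nbhs x A <-> exists N, cylinder (iprefix x N) `<=` A.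
Proof.
split=> [|[N NA]].
  rewrite nbhsE => -[B [[D' sD' <-] [C DC Cx] sBA]].
  have [mu _ muC] := sD' _ DC; rewrite /= -muC in Cx.
  have /cylinderE muE := Cx.
  exists (size mu); rewrite -muE => y muy; apply: sBA; exists C => //=.
  by rewrite -muC.
apply: (filterS NA); apply: open_nbhs_nbhs; split.
  exists [set cylinder (iprefix x N)]; last by rewrite bigcup_set1.
  by move=> _ ->; exists (iprefix x N).
exact/cylinder_iprefix.
Qed.

(** Distinct paths have distinct prefixes, and finitely many of them are told
    apart by prefixes of one common length. *)
Lemma cylinder_isolate (F : set (infpath E)) x : finite_set F ->
  exists N, forall y, F y -> cylinder (iprefix x N) y -> y = x.
Proof.
move=> /finite_seqP[s ->]; elim: s => [|y s [N IHs]]; first by exists 0%N.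
have [M HM] : exists M, cylinder (iprefix x M) y -> y = x.
  apply/not_existsP => yx.
  have /iprefix_inj xy : forall M, iprefix x M = iprefix y M.
    move=> M; have /not_implyP[/cylinder_iprefix //] := yx M.
  by apply: (yx 0%N); rewrite xy.
exists (maxn M N) => w /= + /cylinder_iprefix xw; rewrite inE => /orP[/eqP wy|ws].
  rewrite wy; apply: HM; apply/cylinder_iprefix; rewrite -wy.
  by apply: iprefix_le xw; rewrite leq_maxl.
apply: IHs => //; apply/cylinder_iprefix.
by apply: iprefix_le xw; rewrite leq_maxr.
Qed.

End PathSpace.

(** * The graph groupoid and its basic bisections *)

Section Groupoid.
Set Implicit Arguments.
Unset Strict Implicit.
Variable E : graph.
Implicit Types (mu nu : fpath E) (g h : groupoid E).

Lemma groupoid_eq g h : grange g = grange h -> gdeg g = gdeg h ->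
  gsource g = gsource h -> g = h.
Proof.
case: g h => x k y gP [x' k' y' hP] /= xx kk yy; subst x' k' y'.
congr Groupoid; exact: Prop_irrelevance.
Qed.

Lemma ginvK : involutive (@ginv E).
Proof. by move=> g; apply: groupoid_eq => //=; rewrite opprK. Qed.

Lemma grange_gmul g h : grange (gmul g h) = grange g.
Proof. by rewrite /gmul; case: pselect. Qed.

Lemma gdeg_gmul g h : gsource g = grange h ->
  gdeg (gmul g h) = gdeg g + gdeg h.
Proof. by rewrite /gmul; case: pselect. Qed.

Lemma gsource_gmul g h : gsource g = grange h ->
  gsource (gmul g h) = gsource h.
Proof. by rewrite /gmul; case: pselect. Qed.

Lemma gmulVK g h : gsource g = grange h -> gmul (ginv g) (gmul g h) = h.
Proof.
move=> gh; have gh' : gsource (ginv g) = grange (gmul g h) by rewrite grange_gmul.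
apply: groupoid_eq.
- by rewrite grange_gmul.
- by rewrite gdeg_gmul // gdeg_gmul //= addKr.
- by rewrite gsource_gmul // gsource_gmul.
Qed.

Lemma gmulKV g h : grange g = grange h -> gmul g (gmul (ginv g) h) = h.
Proof. by move=> gh; rewrite -{1}[g]ginvK gmulVK. Qed.

Lemma gmulVg g : gmul (ginv g) g = gunit (gsource g).
Proof.
apply: groupoid_eq.
- by rewrite grange_gmul.
- by rewrite gdeg_gmul //= addNr.
- by rewrite gsource_gmul.
Qed.

Lemma ZsetE mu nu g : Zset mu nu g <->
  [/\ mu = iprefix (grange g) (size mu), nu = iprefix (gsource g) (size nu),
      ishift (grange g) (size mu) = ishift (gsource g) (size nu)
    & gdeg g = (size mu)%:Z - (size nu)%:Z].
Proof.
split=> [[z [/is_icatE[? zx] /is_icatE[? zy] ?]]|[? ? xy ?]].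
  by split=> //; rewrite -zx.
exists (ishift (grange g) (size mu)); split=> //; apply/is_icatE; split=> //.
Qed.

Lemma Zset_ginv mu nu g : Zset mu nu (ginv g) <-> Zset nu mu g.
Proof.
by split=> -[z [? ? dg]]; exists z; split=> //=;
  apply: oppr_inj; rewrite opprB // -dg /= opprK.
Qed.

(** Basic bisections really are bisections; this is what makes the fibres of
    the support of a finite combination finite. *)
Lemma Zset_inj_grange mu nu g h : Zset mu nu g -> Zset mu nu h ->
  grange g = grange h -> g = h.
Proof.
move=> [z [/is_icatE[_ zg] nug dg]] [w [/is_icatE[_ wh] nuh dh]] gh.
apply: groupoid_eq => //; first by rewrite dg dh.
by apply: is_icat_inj nug _; rewrite zg gh -wh.
Qed.

Lemma Zset_unit mu g : Zset mu mu g -> g = gunit (gsource g).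
Proof.
move=> [z [mug mug' dg]]; apply: groupoid_eq => //=; last by rewrite dg subrr.
exact: is_icat_inj mug mug'.
Qed.

Lemma Zset_cylinder mu (x : infpath E) : Zset mu mu (gunit x) <-> cylinder mu x.
Proof.
split=> [[z [mux _ _]]|[z mux]]; exists z => //=.
by split; rewrite ?subrr.
Qed.

(** With x = r(g) and y = s(g), this is Z(x_1...x_a, y_1...y_b). It contains g
    exactly when a - b is the degree of g and the tails of x after a and of y
    after b agree; such sets form a neighbourhood base at g. *)
Definition Znear g a b : set (groupoid E) :=
  Zset (iprefix (grange g) a) (iprefix (gsource g) b).

Lemma ZnearE g a b h : Znear g a b h <->
  [/\ iprefix (grange g) a = iprefix (grange h) a,
      iprefix (gsource g) b = iprefix (gsource h) b,
      ishift (grange h) a = ishift (gsource h) b & gdeg h = a%:Z - b%:Z].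
Proof. by rewrite /Znear ZsetE !size_iprefix. Qed.

Lemma Znear_self g N : exists a b, [/\ (N <= a)%N, (N <= b)%N & Znear g a b g].
Proof.
have /in_groupoidE[a [b [dg xy]]] := groupoidP g.
exists (a + N)%N, (b + N)%N; rewrite !leq_addl; split=> //.
apply/ZnearE; split=> //; first by rewrite -!ishiftD xy.
by rewrite dg; lia.
Qed.

(** Let x and y be the range and source of h. Membership of h in Z(mu, nu)
    asks that x and y start with mu and nu and continue equally from there. Up
    to the positions a and b this concerns letters that h shares with g; beyond
    them, x and y continue equally because h is in a bisection of the form
    [Znear g a b]. *)
Lemma Zset_open mu nu g h a b : (size mu <= a)%N -> (size nu <= b)%N ->
  Znear g a b g -> Znear g a b h -> Zset mu nu g -> Zset mu nu h.
Proof.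
move=> lea leb /ZnearE[_ _ _ dg] /ZnearE[px py tail dh] /ZsetE[muE nuE tailg dg'].
have dgh : a%:Z - b%:Z = (size mu)%:Z - (size nu)%:Z by rewrite -dg.
apply/ZsetE; split; rewrite ?dh //.
- by rewrite {1}muE; apply: iprefix_le px.
- by rewrite {1}nuE; apply: iprefix_le py.
apply: infpath_eq => i /=; have [lti|lei] := ltnP (size mu + i) a.
  rewrite -(iprefix_nth px) // -(iprefix_nth py); last by lia.
  exact: (congr1 (fun z : infpath E => z i) tailg).
have -> : (size mu + i = a + (size mu + i - a))%N by lia.
have -> : (size nu + i = b + (size mu + i - a))%N by lia.
exact: (congr1 (fun z : infpath E => z (size mu + i - a)%N) tail).
Qed.

(** As z varies, the elements (mu z, |mu| - |nu|, nu z) of a basic bisection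
    have all of the cylinder over nu as their sources. *)
Lemma Znear_lift g a b (y : infpath E) : Znear g a b g ->
  cylinder (iprefix (gsource g) b) y ->
  exists2 h, Znear g a b h & gsource h = y.
Proof.
move=> /ZnearE[_ _ tail _] [z yz].
have [x xz] : exists x, is_icat (iprefix (grange g) a) z x.
  apply: icat_exists; rewrite (is_icat_prefix _ _).1 tail -(is_icat_prefix _ _).1.
  by case: yz.
have inG : in_groupoid x (a%:Z - b%:Z) y.
  exists (iprefix (grange g) a), (iprefix (gsource g) b), z.
  by rewrite !size_iprefix.
by exists (Groupoid inG) => //; exists z; rewrite !size_iprefix.
Qed.

Lemma Znear_sym g h a b : Znear g a b g -> Znear g a b h ->
  Znear h a b h /\ Znear h a b g.
Proof.
move=> /ZnearE[_ _ ? ?] /ZnearE[? ? ? ?].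
by split; apply/ZnearE.
Qed.

Lemma Zset_locally_constant mu nu g h a b : (size mu <= a)%N -> (size nu <= b)%N ->
  Znear g a b g -> Znear g a b h -> Zset mu nu h <-> Zset mu nu g.
Proof.
move=> lea leb gg gh; have [hh hg] := Znear_sym gg gh.
by split; [exact: Zset_open hh hg | exact: Zset_open gg gh].
Qed.

End Groupoid.

(** * Convolution and the Steinberg algebra *)

Lemma finite_argmax (T : choiceType) (F : set T) (t : T -> int) :
  finite_set F -> F !=set0 -> exists2 x, F x & forall y, F y -> t y <= t x.
Proof.
move=> /finite_seqP[s ->] [x0 /= x0s].
suff [x xs xmax] : exists2 x, x \in x0 :: s & forall y, y \in x0 :: s -> t y <= t x.
  exists x => /=; first by move: xs; rewrite inE => /predU1P[->|].
  by move=> y ys; apply: xmax; rewrite inE ys orbT.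
elim: s x0 {x0s} => [|z s IHs] x0.
  by exists x0 => [|y]; rewrite inE // => /eqP ->.
have [x xs xmax] := IHs z.
have [le|lt] := lerP (t x0) (t x); [exists x|exists x0].
- by rewrite inE xs orbT.
- by move=> y; rewrite inE => /predU1P[->//|/xmax].
- exact: mem_head.
- by move=> y; rewrite inE => /predU1P[->//|/xmax ylex]; rewrite (le_trans ylex) ?ltW.
Qed.

Section Convolution.
Set Implicit Arguments.
Unset Strict Implicit.
Variables (E : graph) (R : idomainType).
Implicit Types (f g d : groupoid E -> R) (gam eta : groupoid E).

Lemma convol_neq0 f g gam : convol f g gam != 0 ->
  exists eta, [/\ grange eta = grange gam, f eta != 0
                & g (gmul (ginv eta) gam) != 0].
Proof.
apply: contra_neqP => /forallNP none; apply: fsbig1 => eta /= etag.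
apply/eqP; rewrite mulf_eq0; apply/negPn; rewrite negb_or; apply/negP.
by move=> /andP[feta geta]; apply: (none eta).
Qed.

Lemma convol_single f g gam eta0 : grange eta0 = grange gam ->
  (forall eta, grange eta = grange gam -> f eta != 0 ->
     g (gmul (ginv eta) gam) != 0 -> eta = eta0) ->
  convol f g gam = f eta0 * g (gmul (ginv eta0) gam).
Proof.
move=> eta0g uniq; rewrite /convol -(@fsbig_widen _ _ _ _ [set eta0]).
- exact: fsbig_set1.
- by move=> eta ->.
move=> eta [/= etag neq].
apply/eqP/negPn; rewrite mulf_eq0 negb_or; apply/negP => /andP[feta geta].
by apply: neq; exact: uniq.
Qed.

(** As r is injective on supp f, at most one left factor has the range of a
    given element, so no cancellation can occur in the convolution. *)
Lemma supp_convol f g : set_inj (supp f) (@grange E) ->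
  supp (convol f g) =
  [set gam | exists a b, [/\ supp f a, supp g b, gsource a = grange b
                           & gam = gmul a b]].
Proof.
move=> injf; apply/seteqP; split=> [gam /convol_neq0[eta [etag feta geta]]|].
  by exists eta, (gmul (ginv eta) gam); split=> //; rewrite ?grange_gmul ?gmulKV.
move=> _ [a [b [fa gb ab ->]]]; rewrite /supp /= (@convol_single _ _ _ a).
- by rewrite gmulVK // mulf_neq0.
- by rewrite grange_gmul.
- move=> eta; rewrite grange_gmul => etaa feta _.
  by apply: injf => //; rewrite inE.
Qed.

Lemma supp_convol_inj_source f g : set_inj (supp f) (@grange E) ->
  set_inj (supp f) (@gsource E) -> set_inj (supp g) (@gsource E) ->
  set_inj (supp (convol f g)) (@gsource E).
Proof.
move=> rf sf sg x y; rewrite supp_convol // !inE.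
move=> [a [b [fa gb ab ->]]] [a' [b' [fa' gb' ab' ->]]].
rewrite !gsource_gmul // => bb'.
have bE : b = b' by apply: sg => //; rewrite inE.
by subst b'; congr gmul; apply: sf; rewrite ?inE // ab.
Qed.

(** Right multiplication by a function supported on units is pointwise
    multiplication by its value at the source. *)
Lemma convol_diagr f d gam : (forall eta, d eta != 0 -> eta = gunit (gsource eta)) ->
  convol f d gam = f gam * d (gunit (gsource gam)).
Proof.
move=> dunit; rewrite (@convol_single _ _ _ gam) ?gmulVg // => eta etag _ /dunit dE.
have := congr1 (@grange E) dE; have := congr1 (@gdeg E) dE.
rewrite grange_gmul gdeg_gmul // gsource_gmul //= => dd ss.
by apply: groupoid_eq => //; lia.
Qed.

Lemma combination_neq0 k (c : 'I_k -> R) (b : 'I_k -> groupoid E -> R) gam :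
  \sum_(i < k) c i * b i gam != 0 -> exists i, b i gam != 0.
Proof.
apply: contra_neqP => /forallNP none; apply: big1 => i _.
by have /negP/negPn/eqP -> := none i; rewrite mulr0.
Qed.

Lemma indic_neq0 (A : set (groupoid E)) gam : (\1_A gam : R) != 0 <-> A gam.
Proof.
rewrite indicE; split=> [|Ag]; last by rewrite mem_set ?oner_eq0.
by case: (boolP (gam \in A)) => [/set_mem|]; rewrite ?eqxx.
Qed.

Lemma eq_indic (A B : set (groupoid E)) gam eta : (A gam <-> B eta) ->
  \1_A gam = \1_B eta :> R.
Proof.
move=> AB; rewrite !indicE; congr (_%:R); congr nat_of_bool.
by apply/idP/idP => /set_mem H; apply/mem_set/AB.
Qed.

Lemma leavitt_diagonal_unit d gam : leavitt_diagonal d -> d gam != 0 ->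
  gam = gunit (gsource gam).
Proof.
move=> [k [c [b [bZ ->]]]] /combination_neq0[i].
by have [mu ->] := bZ i; move=> /indic_neq0; exact: Zset_unit.
Qed.

Lemma leavitt_diagonal_indic (mu : fpath E) :
  leavitt_diagonal (\1_(Zset mu mu) : groupoid E -> R).
Proof.
exists 1%N, (fun=> 1), (fun=> \1_(Zset mu mu)); split=> [_|]; first by exists mu.
by apply/funext => gam; rewrite big_ord1 mul1r.
Qed.

Lemma leavitt_finite_fiber f y : leavitt f ->
  finite_set (supp f `&` [set gam | grange gam = y]).
Proof.
move=> [k [c [b [bZ fE]]]].
have sub : supp f `&` [set gam | grange gam = y] `<=`
    \bigcup_(i in [set: 'I_k]) (supp (b i) `&` [set gam | grange gam = y]).
  by move=> gam []; rewrite fE /supp /= => /combination_neq0[i bi] ?; exists i.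
apply: sub_finite_set sub _; apply: bigcup_finite => // i _.
have [mu [nu [_ ->]]] := bZ i.
have [[g [/indic_neq0 gZ /= gy]]|] :=
    pselect ((supp (\1_(Zset mu nu) : _ -> R) `&` [set gam | grange gam = y]) !=set0).
  apply: (@sub_finite_set _ _ [set g]) => // h [/indic_neq0 hZ /= hy].
  by apply: Zset_inj_grange hZ gZ _; rewrite hy.
by move=> /nonemptyPn ->.
Qed.

(** The length N must exceed all the paths occurring in an expression of f as a
    combination of the indicators of basic bisections. *)
Lemma leavitt_locally_constant f gam : leavitt f ->
  exists N, forall a b eta, (N <= a)%N -> (N <= b)%N ->
    Znear gam a b gam -> Znear gam a b eta -> f eta = f gam.
Proof.
move=> [k [c [b [bZ ->]]]].
have /choice[N NP] : forall i, exists N, forall p q eta, (N <= p)%N -> (N <= q)%N ->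
    Znear gam p q gam -> Znear gam p q eta -> b i eta = b i gam.
  move=> i; have [mu [nu [_ ->]]] := bZ i.
  exists (maxn (size mu) (size nu)) => p q eta; rewrite !geq_max.
  move=> /andP[mup _] /andP[_ nuq] gg ge.
  exact/eq_indic/(Zset_locally_constant mup nuq gg ge).
exists (\max_(i < k) N i)%N => p q eta Np Nq gg ge.
apply: eq_bigr => i _; congr (_ * _).
have Ni : (N i <= \max_(j < k) N j)%N by exact: leq_bigmax.
exact: NP (leq_trans Ni Np) (leq_trans Ni Nq) gg ge.
Qed.

End Convolution.

(** * Supports of normalizers *)

Section Normalizer.
Set Implicit Arguments.
Unset Strict Implicit.
Variables (E : graph) (R : idomainType) (bar : {rmorphism R -> R}).
Hypothesis barK : involutive bar.
Implicit Types (f d n m : groupoid E -> R) (gam eta g h : groupoid E).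

Lemma bar_eq0 (a : R) : (bar a == 0) = (a == 0).
Proof. by rewrite -(inj_eq (inv_inj barK)) barK rmorph0. Qed.

Lemma fstar_eq0 f gam : (fstar bar f gam == 0) = (f (ginv gam) == 0).
Proof. exact: bar_eq0. Qed.

Lemma supp_fstar f gam : supp (fstar bar f) gam = supp f (ginv gam).
Proof. by rewrite /supp /= fstar_eq0. Qed.

Lemma fstarK f : fstar bar (fstar bar f) = f.
Proof. by apply/funext => gam; rewrite /fstar barK ginvK. Qed.

Lemma leavitt_star f : leavitt f -> leavitt (fstar bar f).
Proof.
move=> [k [c [b [bZ ->]]]]; exists k, (bar \o c), (fun i => b i \o @ginv E).
split=> [i|].
  have [mu [nu [munu ->]]] := bZ i; exists nu, mu; split=> //.
  by apply/funext => gam /=; apply/eq_indic/Zset_ginv.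
apply/funext => gam; rewrite /fstar rmorph_sum; apply: eq_bigr => i _ /=.
rewrite rmorphM; congr (_ * _).
by have [mu [nu [_ ->]]] := bZ i; rewrite indicE rmorph_nat.
Qed.

Lemma leavitt_normalizer_star n :
  leavitt_normalizer bar n -> leavitt_normalizer bar (fstar bar n).
Proof.
move=> [nL nN]; split; first exact: leavitt_star.
by move=> d dD; rewrite fstarK; have [? ?] := nN d dD.
Qed.

(** Let x be the common source of g and h and let d be the indicator of a
    cylinder around x so small that x is the only source it contains of an
    element of supp n with range r(g). The coefficient of n d n^* at g h^-1 is
    a sum over elements e : x -> r(g) of supp n with h g^-1 e in supp n. Here e
    has degree at most that of g, and h g^-1 e has degree at least that of h, so
    e has the degree of g, hence e = g. The coefficient is therefore
    n(g) bar(n(h)), which is nonzero as R is a domain. But n d n^* is supported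
    on units, so g h^-1 is a unit. *)
Lemma normalizer_extremal n g h : leavitt_normalizer bar n ->
  supp n g -> supp n h -> gsource g = gsource h ->
  (forall e, supp n e -> gsource e = gsource g -> grange e = grange g ->
     gdeg e <= gdeg g) ->
  (forall e, supp n e -> gsource e = gsource h -> grange e = grange h ->
     gdeg h <= gdeg e) ->
  grange g = grange h /\ gdeg g = gdeg h.
Proof.
move=> [nL nN] ng nh gh gmax hmin.
have [N iso] := cylinder_isolate (gsource g)
  (finite_image (@gsource E) (leavitt_finite_fiber (grange g) nL)).
pose p := iprefix (gsource g) N.
have dD := leavitt_diagonal_indic R p.
have ghV : gsource g = grange (ginv h) by [].
have ndE e : convol n \1_(Zset p p) e = n e * \1_(Zset p p) (gunit (gsource e)).
  by apply: convol_diagr => eta; exact: leavitt_diagonal_unit.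
have coef : convol (convol n \1_(Zset p p)) (fstar bar n) (gmul g (ginv h)) != 0.
  rewrite (@convol_single _ _ _ _ _ g).
  - rewrite gmulVK // ndE mulf_neq0 //; last by rewrite fstar_eq0 ginvK.
    rewrite mulf_neq0 //; apply/indic_neq0/Zset_cylinder.
    exact/cylinder_iprefix.
  - by rewrite grange_gmul.
  - move=> e; rewrite grange_gmul => eg; rewrite ndE mulf_eq0 negb_or.
    move=> /andP[ne /indic_neq0/Zset_cylinder ep].
    have eVg : gsource (ginv e) = grange (gmul g (ginv h)) by rewrite grange_gmul.
    have eg' : gsource e = gsource g by apply: iso => //; exists e.
    rewrite fstar_eq0 => /hmin /=.
    rewrite !gsource_gmul // !gdeg_gmul // grange_gmul /= => hmin'.
    have := hmin' (etrans eg' gh) erefl; have := gmax e ne eg' eg => ? ?.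
    by apply: groupoid_eq => //; lia.
have [/leavitt_diagonal_unit/(_ coef) gE _] := nN _ dD.
have := congr1 (@grange E) gE; have := congr1 (@gdeg E) gE.
rewrite grange_gmul gdeg_gmul // gsource_gmul //= => ? ->.
by split=> //; lia.
Qed.

(** Among the finitely many elements of supp n with the source of g and h, take
    g' of maximal degree with the range of g, and h' of minimal degree with the
    range of h. By extremality g' and h' have equal ranges and degrees, so g and
    h have the same range, and the maximal and minimal degrees over that range
    coincide. *)
Lemma normalizer_inj_source n :
  leavitt_normalizer bar n -> set_inj (supp n) (@gsource E).
Proof.
move=> nN g h; rewrite !inE => ng nh gh.
have fin y : finite_set (supp n `&` [set e | gsource e = gsource g /\ grange e = y]).
  apply: sub_finite_set (leavitt_finite_fiber y nN.1).
  by move=> e [ne [_ ey]].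
have [|g' [ng' [sg' rg']] gmax] := @finite_argmax _ _ (@gdeg E) (fin (grange g)).
  by exists g.
have [|h' [nh' [sh' rh']] hmin] :=
    @finite_argmax _ _ (fun e => - gdeg e) (fin (grange h)).
  by exists h.
have [rgh dgh] : grange g' = grange h' /\ gdeg g' = gdeg h'.
  apply: (normalizer_extremal nN) => //; first by rewrite sg' sh'.
    by move=> e ne es er; apply: gmax; split=> //; rewrite /= es er sg' rg'.
  move=> e ne es er; rewrite -lerN2.
  by apply: hmin; split=> //; rewrite /= es er sh' rh'.
have rE : grange g = grange h by rewrite -rg' rgh rh'.
have deg e : supp n e -> gsource e = gsource g -> grange e = grange g ->
    gdeg e = gdeg g'.
  move=> ne es er; apply/eqP; rewrite eq_le; apply/andP; split.
    by apply: gmax.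
  rewrite dgh -lerN2; apply: hmin; split=> //=.
  by rewrite es er rE.
by apply: groupoid_eq => //; rewrite !deg.
Qed.

Lemma normalizer_inj_range n :
  leavitt_normalizer bar n -> set_inj (supp n) (@grange E).
Proof.
move=> /leavitt_normalizer_star/normalizer_inj_source inj g h; rewrite !inE => ng nh gh.
apply: (can_inj (@ginvK E)); apply: inj => //.
- by rewrite inE supp_fstar ginvK.
- by rewrite inE supp_fstar ginvK.
Qed.

(** * The partial homeomorphism of a normalizer *)

Lemma DomE n : set_inj (supp n) (@gsource E) -> Dom bar n = @gsource E @` supp n.
Proof.
move=> inj; apply/seteqP; split=> [x|_ [g ng <-]].
  move=> /convol_neq0[eta [/= etax]].
  by rewrite fstar_eq0 => neta _; exists (ginv eta).
rewrite /Dom /= supp_convol; last first.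
  move=> a b; rewrite !inE !supp_fstar => na nb ab.
  by apply: (can_inj (@ginvK E)); apply: inj; rewrite ?inE.
exists (ginv g), g; split=> //; last by rewrite gmulVg.
by rewrite supp_fstar ginvK.
Qed.

Lemma RanE n : Ran bar n = Dom bar (fstar bar n).
Proof. by rewrite /Dom fstarK. Qed.

Lemma alphaE n g : set_inj (supp n) (@gsource E) -> supp n g ->
  alpha n (gsource g) = grange g.
Proof.
move=> inj ng; apply: xget_unique; first by exists g.
move=> _ [h [nh /= hg] <-]; congr grange.
by apply: inj; rewrite ?inE.
Qed.

(** Let g : x -> y be in supp n. Then n is nonzero on a whole bisection
    Z(y_1...y_a, x_1...x_b) around g with a arbitrarily large, and this
    bisection carries Z(x_1...x_b) into Z(y_1...y_a). *)
Lemma alpha_continuous n : leavitt_normalizer bar n ->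
  {within Dom bar n, continuous (alpha n)}.
Proof.
move=> nN; have inj := normalizer_inj_source nN.
rewrite subspace_continuousP => x; rewrite (DomE inj) => -[g ng <-].
rewrite /from_subspace (alphaE inj ng) => A /nbhs_cylinderP[N NA].
have [M Mn] := leavitt_locally_constant g nN.1.
have [a [b [+ + gg]]] := Znear_self g (maxn N M).
rewrite !geq_max => /andP[Na Ma] /andP[_ Mb].
apply/nbhs_cylinderP; exists b => y gy _.
have [h gh <-] := Znear_lift gg gy.
have nh : supp n h by rewrite /supp /= (Mn a b h).
rewrite /= (alphaE inj nh); apply: NA; apply/cylinder_iprefix.
by have /ZnearE[pre _ _ _] := gh; apply: iprefix_le pre.
Qed.

Lemma alpha_fstarK n x : leavitt_normalizer bar n -> Dom bar n x ->
  Ran bar n (alpha n x) /\ alpha (fstar bar n) (alpha n x) = x.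
Proof.
move=> nN; have nN' := leavitt_normalizer_star nN.
have inj := normalizer_inj_source nN; have inj' := normalizer_inj_source nN'.
rewrite RanE !DomE // => -[g ng <-]; rewrite (alphaE inj ng).
have ng' : supp (fstar bar n) (ginv g) by rewrite supp_fstar ginvK.
by split; [exists (ginv g) | exact: (alphaE inj' ng')].
Qed.

Lemma Dom_convol m n : leavitt_normalizer bar m -> leavitt_normalizer bar n ->
  Dom bar (convol m n) = [set x | Dom bar n x /\ Dom bar m (alpha n x)].
Proof.
move=> mN nN; have sm := normalizer_inj_source mN; have sn := normalizer_inj_source nN.
have rm := normalizer_inj_range mN.
rewrite !DomE //; last exact: supp_convol_inj_source.
rewrite supp_convol //; apply/seteqP; split=> [_ [_ [g [h [mg nh gh ->]] <-]]|x /=].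
  rewrite /= gsource_gmul // (alphaE sn nh) -gh; split; [by exists h|by exists g].
move=> [[h nh <-]]; rewrite (alphaE sn nh) => -[g mg gh].
exists (gmul g h); last by rewrite gsource_gmul.
by exists g, h.
Qed.

Lemma alpha_convol m n x : leavitt_normalizer bar m -> leavitt_normalizer bar n ->
  Dom bar (convol m n) x -> alpha m (alpha n x) = alpha (convol m n) x.
Proof.
move=> mN nN; have sm := normalizer_inj_source mN; have sn := normalizer_inj_source nN.
have rm := normalizer_inj_range mN.
have smn := supp_convol_inj_source rm sm sn.
rewrite DomE // => -[gam mngam <-]; rewrite (alphaE smn mngam).
move: mngam; rewrite supp_convol // => -[g [h [mg nh gh ->]]].
by rewrite gsource_gmul // (alphaE sn nh) -gh (alphaE sm mg) grange_gmul.
Qed.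

End Normalizer.

Theorem proposition3p7 (E : graph) (hfin : row_finite E) (hsrc : no_sources E)
    (R : idomainType) (bar : {rmorphism R -> R}) (barK : involutive bar)
    (m n d : groupoid E -> R)
    (hm : leavitt_normalizer bar m) (hn : leavitt_normalizer bar n) (hd : leavitt_diagonal d) :
  [/\ (* (1) *)
      (forall x, Dom bar (convol m n) x <-> Dom bar n x /\ Dom bar m (alpha n x))
      /\ (forall x, Dom bar (convol m n) x ->
            alpha m (alpha n x) = alpha (convol m n) x),
      (* (2) *)
      supp d = @gunit E @` Dom bar d
      /\ (forall x, Dom bar d x -> alpha d x = x)
    & (* (3) *)
      [/\ Ran bar n = Dom bar (fstar bar n),
          set_bij (Dom bar n) (Ran bar n) (alpha n),
          {within Dom bar n, continuous (alpha n)},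
          {within Ran bar n, continuous (alpha (fstar bar n))}
        & (forall x, Dom bar n x -> alpha (fstar bar n) (alpha n x) = x)
          /\ (forall y, Ran bar n y -> alpha n (alpha (fstar bar n) y) = y)]].
Proof.
have dU gam : supp d gam -> gam = gunit (gsource gam) by exact: leavitt_diagonal_unit.
have dinj : set_inj (supp d) (@gsource E).
  by move=> g h; rewrite !inE => /dU gE /dU hE gh; rewrite gE hE gh.
have hn' := leavitt_normalizer_star barK hn.
have DomRan x : Dom bar n x ->
    Ran bar n (alpha n x) /\ alpha (fstar bar n) (alpha n x) = x.
  exact: (alpha_fstarK barK hn).
have RanDom y : Ran bar n y ->
    Dom bar n (alpha (fstar bar n) y) /\ alpha n (alpha (fstar bar n) y) = y.
  rewrite (RanE barK) => /(alpha_fstarK barK hn').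
  by rewrite (RanE barK) (fstarK barK).
split.
- split=> x; last exact: (alpha_convol barK).
  by rewrite (Dom_convol barK hm hn).
- rewrite (DomE barK dinj); split=> [|_ [g dg <-]].
    apply/seteqP; split=> [gam dgam|_ [_ [g dg <-] <-]]; last by rewrite -(dU _ dg).
    by exists (gsource gam); [exists gam | rewrite -(dU _ dgam)].
  by rewrite (alphaE dinj dg) {1}(dU _ dg).
split.
- exact: (RanE barK).
- split=> [x /DomRan[] //|x y|y /RanDom[? ?]]; last by exists (alpha (fstar bar n) y).
  by rewrite !inE => /DomRan[_ xE] /DomRan[_ yE] xy; rewrite -xE -yE xy.
- exact: (alpha_continuous barK hn).
- by rewrite (RanE barK); exact: (alpha_continuous barK hn').
- by split=> [x /DomRan[]|y /RanDom[]].
Qed.
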